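(* For an integer $n \ge 3$, let $N := \lfloor \log_2 \log_5 n \rfloor + 1$ and \[ g(n) := n^2 - \left(\sum_{j=1}^N \frac{n^{1 + \frac{1}{2^j}}}{2^{j-1}} \right) + \left(2 - \frac{1}{2^{N-1}}\right)n. \] Then for all integers $n \ge 3$, $|b(n) - g(n)| < 2n$.
   Context: A reachable pair of a digraph $\Gamma$ is an ordered pair $(\alpha,\beta)$ of (not necessarily distinct) vertices such that there is a directed path (possibly of length $0$) from $\alpha$ to $\beta$; the weight $w(\Gamma)$ is the number of reachable pairs. For $n\in\mathbb{N}$, $W(n)$ is the set of all integers $k$ such that some digraph on $n$ vertices has weight $k$. For $n \in \mathbb{N}$, $b(n)$ is the largest integer such that every integer $k$ with $n \le k \le b(n)$ lies in $W(n)$. *)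

(* Defs.v *)
From mathcomp Require Import all_boot all_order all_algebra.
From mathcomp Require Import all_classical all_reals all_analysis.

Set Implicit Arguments.
Unset Strict Implicit.
Unset Printing Implicit Defensive.

Import Order.TTheory GRing.Theory Num.Theory.

(* A digraph on n vertices is given by its set of arcs. Loops are allowed, but
   they do not change reachability, hence do not change the weight. *)
Definition digraph (n : nat) := {set 'I_n * 'I_n}.

Definition arc n (G : digraph n) : rel 'I_n := [rel x y | (x, y) \in G].

Definition reachable_pairs n (G : digraph n) : {set 'I_n * 'I_n} :=
  [set p | connect (arc G) p.1 p.2].

Definition weight n (G : digraph n) : nat := #|reachable_pairs G|.

Definition W (n : nat) : {pred nat} :=
  [pred k | [exists G : digraph n, weight G == k]].

Definition all_weights_upto (n : nat) : pred nat :=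
  fun m => [forall k : 'I_m.+1, (n <= k) ==> (val k \in W n)].

Lemma all_weights_uptoP n m :
  reflect (forall k, n <= k <= m -> k \in W n) (all_weights_upto n m).
Proof.
apply: (iffP forallP) => [H k /andP[nk km] | H k].
  by have /implyP := H (Ordinal (km : k < m.+1)); apply.
by apply/implyP => nk; apply: H; rewrite nk -ltnS ltn_ord.
Qed.

Lemma W_le_sqr n k : k \in W n -> k <= n ^ 2.
Proof.
rewrite inE => /existsP[G /eqP <-].
by apply: leq_trans (max_card _) _; rewrite card_prod !card_ord.
Qed.

Lemma n_in_W n : n \in W n.
Proof.
rewrite inE; apply/existsP; exists finset.set0; apply/eqP.
rewrite /weight -[RHS]card_ord -(card_imset predT (f := fun x : 'I_n => (x, x))).
  apply: eq_card => -[x y]; rewrite inE /=; apply/connectP/imsetP.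
    case=> [[|z p] /= ]; first by move=> _ ->; exists x.
    by rewrite /arc /= finset.in_set0.
  by case=> z _ [-> ->]; exists [::].
by move=> x y [].
Qed.

Lemma all_weights_upto_ex n : exists m, all_weights_upto n m.
Proof.
exists n; apply/all_weights_uptoP => k.
by rewrite -eqn_leq => /eqP <-; exact: n_in_W.
Qed.

Lemma all_weights_upto_bound n m : all_weights_upto n m -> m <= n ^ 2.
Proof.
move/all_weights_uptoP => H; case: (leqP n m) => [nm | /ltnW mn].
  by apply/W_le_sqr/H; rewrite nm leqnn.
by apply: leq_trans mn _; case: (n) => // k; rewrite expnS leq_pmulr.
Qed.

(* Maximising over nat rather than over the integers is harmless, as n itself
   satisfies the condition. *)
Definition b (n : nat) : nat :=
  ex_maxn (all_weights_upto_ex n) (@all_weights_upto_bound n).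

Local Open Scope ring_scope.

Definition log (R : realType) (a x : R) : R := ln x / ln a.

(* For n = 3 and n = 4 the double logarithm is negative and N n = 0. *)
Definition N (R : realType) (n : nat) : int :=
  Num.floor (log 2 (log 5 (n%:R : R))) + 1.

Definition g (R : realType) (n : nat) : R :=
  n%:R ^+ 2
  - (\sum_(1 <= j < (Num.truncn (N R n)).+1)
        n%:R `^ (1 + 1 / 2 ^+ j) / 2 ^+ (j - 1))
  + (2 - 1 / 2 ^ (N R n - 1)) * n%:R.

(* Main.v *)
Require Import Defs.
From Stdlib Require Import NArith.
From mathcomp Require Import all_boot all_order all_algebra.
From mathcomp Require Import all_classical all_reals all_analysis.
From mathcomp Require Import zify ring lra.

(** Write b n = n^2 - n h n and g n = n^2 - n f n; the claim is |h n - f n| < 2.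
    The exponents in g make f satisfy f x = sqrt x - 1 + f (sqrt x) / 2 for
    x >= 5 and f = 0 on [sqrt 5, 5).

    A strong component with n - q vertices dominating a digraph on the other q
    realises (n - q) n + [q, b q]. If p is the largest number with
    b p < n + p - 2, the intervals for q > p overlap and so
    b n >= (n - p) n + b p. Conversely a digraph of weight (n - p) n + x must
    have a huge strong component, and shrinking it gives a digraph on p vertices
    of weight x; with x = b p + 1 this shows b n <= (n - p) n + b p.
    Inductive bounds on b p then give p = sqrt n + f (sqrt n) / 2 + O(1), and
    both estimates of h n follow from the recursion for f. The lower bound on b
    has little slack, so for n < 625^2 it is verified on a computed table. *)

Set Implicit Arguments.
Unset Strict Implicit.
Unset Printing Implicit Defensive.

Import Order.TTheory GRing.Theory Num.Theory.

(** * Weights as sizes of preorders *)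

Definition npairs (T : finType) (R : rel T) : nat := \sum_x \sum_y R x y.

Lemma weightE n (G : digraph n) : weight G = npairs (connect (Defs.arc G)).
Proof.
rewrite /weight /npairs -sum1_card pair_bigA /= big_mkcond /=.
by apply: eq_bigr => -[x y] _; rewrite inE /=; case: connect.
Qed.

Lemma connect_preorder (T : finType) (R : rel T) :
  reflexive R -> transitive R -> connect R =2 R.
Proof.
move=> Rxx Rtr x y; apply/idP/idP; last exact: connect1.
case/connectP => p; elim: p x => [x _ -> //|z p IH x /= /andP[xz zp] yE].
exact: Rtr xz (IH _ zp yE).
Qed.

Lemma npairs_in_W (T : finType) (R : rel T) n :
  reflexive R -> transitive R -> #|T| = n -> npairs R \in W n.
Proof.
move=> Rxx Rtr Tn.
pose f i : T := enum_val (cast_ord (esym Tn) i).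
have f_bij : bijective f.
  exists (fun x => cast_ord Tn (enum_rank x)) => x; rewrite /f.
    by rewrite enum_valK cast_ordKV.
  by rewrite cast_ordK enum_rankK.
pose G : digraph n := [set u | R (f u.1) (f u.2)]%SET.
have arcE : Defs.arc G =2 fun x y => R (f x) (f y).
  by move=> x y; rewrite /Defs.arc /= inE.
rewrite inE; apply/existsP; exists G; apply/eqP.
rewrite weightE /npairs [RHS](reindex f) /=; last exact: onW_bij.
apply: eq_bigr => x _; rewrite [RHS](reindex f) /=; last exact: onW_bij.
apply: eq_bigr => y _; rewrite -arcE.
have arc_refl : reflexive (Defs.arc G) by move=> z; rewrite arcE.
have arc_trans : transitive (Defs.arc G) by move=> u v w; rewrite !arcE; apply: Rtr.
by rewrite connect_preorder.
Qed.

Lemma in_W_preorder n k :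
  k \in W n -> exists R : rel 'I_n, [/\ reflexive R, transitive R & npairs R = k].
Proof.
rewrite inE => /existsP[G /eqP <-]; exists (connect (Defs.arc G)); rewrite weightE.
by split=> //; exact: connect_trans.
Qed.

(** Seen from [T], the vertices of [U] are interchangeable. This covers both one digraph dominating
    another and a full block reinserted in place of a strong component. *)
Definition sum_rel (T U : finType) (R : rel T) (A : T -> bool) (B : T -> bool)
    (Q : rel U) : rel (T + U) := fun u v =>
  match u, v with
  | inl x, inl y => R x y
  | inl x, inr _ => A x
  | inr _, inl y => B y
  | inr x, inr y => Q x y
  end.

Lemma npairs_sum_rel (T U : finType) (R : rel T) A B (Q : rel U) :
  npairs (sum_rel R A B Q) =
  npairs R + npairs Q + #|U| * (\sum_x A x + \sum_x B x).
Proof.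
rewrite /npairs big_sumType /=.
rewrite (eq_bigr (fun x => (\sum_y R x y) + #|U| * A x)); last first.
  by move=> x _; rewrite big_sumType /= sum_nat_const.
rewrite [X in _ + X = _](eq_bigr (fun x => (\sum_y B y) + \sum_y Q x y)); last first.
  by move=> x _; rewrite big_sumType /=.
rewrite !big_split /= -big_distrr /= sum_nat_const mulnDr. rewrite (eq_card (B := U)) //; lia.
Qed.

Lemma W_add (e : bool) m n k l :
  k \in W m -> l \in W n -> k + l + e * (m * n) \in W (m + n).
Proof.
move=> /in_W_preorder[R [Rxx Rtr <-]] /in_W_preorder[Q [Qxx Qtr <-]].
pose S := sum_rel R (fun=> e) (fun=> false) Q.
have -> : npairs R + npairs Q + e * (m * n) = npairs S.
  rewrite /S npairs_sum_rel !sum_nat_const !card_ord; lia.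
apply: npairs_in_W; last by rewrite card_sum !card_ord.
  by case=> x /=.
by case=> x [y|y] [z|z] //=; [apply: Rtr | apply: Qtr].
Qed.

Lemma W_sqr n : n ^ 2 \in W n.
Proof.
have -> : n ^ 2 = npairs (fun _ _ : 'I_n => true).
  by rewrite /npairs !sum_nat_const !card_ord muln1 mulnn.
by apply: npairs_in_W; rewrite ?card_ord.
Qed.

(** * Recursive bounds on b *)

Lemma b_all n k : n <= k <= b n -> k \in W n.
Proof.
by rewrite /b; case: ex_maxnP => m /all_weights_uptoP mW _; exact: mW.
Qed.

Lemma b_max n m : (forall k, n <= k <= m -> k \in W n) -> m <= b n.
Proof.
move=> mW; rewrite /b; case: ex_maxnP => i _; apply.
exact/all_weights_uptoP.
Qed.

Lemma b_ge n : n <= b n.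
Proof. by apply: b_max => k; rewrite -eqn_leq => /eqP <-; exact: n_in_W. Qed.

Lemma b_notin n : (b n).+1 \notin W n.
Proof.
apply/negP => bW; suff: (b n).+1 <= b n by rewrite ltnn.
apply: b_max => k /andP[nk]; rewrite leq_eqVlt => /orP[/eqP -> //|].
by rewrite ltnS => kb; apply: b_all; rewrite nk.
Qed.

Lemma b_lt n k : n <= k -> k \notin W n -> b n < k.
Proof. by move=> nk kW; rewrite ltnNge; apply: contra kW => kb; apply: b_all; rewrite nk. Qed.

Lemma b_le_sqr n : b n <= n ^ 2.
Proof. by apply: W_le_sqr; apply: b_all; rewrite b_ge leqnn. Qed.

Lemma W_dominate n q l : q <= n -> l \in W q -> (n - q) * n + l \in W n.
Proof.
move=> qn lW; have := W_add true (W_sqr (n - q)) lW.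
by rewrite subnK //; congr (_ \in W n); nia.
Qed.

(* A full digraph on n - q vertices joined to one on q vertices realises
   (n - q) n + [q, b q]; these intervals overlap for consecutive q as soon as
   b q >= n + q - 2. *)
Lemma b_fill n p : p.+1 < n -> (forall q, p < q < n -> n + q - 2 <= b q) ->
  (n - p) * n + b p <= b n.
Proof.
move=> pn bq.
(* An isolated vertex is added to a digraph on [n.-1] vertices, where [bq] gives b (n - 1) >= 2 n -
   3. *)
have low k : n <= k <= 2 * n - 2 -> k \in W n.
  case/andP=> nk kn; have k1 : k.-1 \in W n.-1.
    by apply: b_all; have := bq n.-1; lia.
  have := W_add false k1 (n_in_W 1).
  have -> : n.-1 + 1 = n by lia.
  by have -> : k.-1 + 1 + false * (n.-1 * 1) = k by lia.
(* Here [i.+1] is the number of dominating vertices. By the overlap, a [k] too small for one more of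
   them is covered by the induction hypothesis. *)
have high i k : i <= n - 1 - p -> 2 * n - 1 <= k ->
    k <= i.+1 * n + b (n - 1 - i) -> k \in W n.
  elim: i k => [|i IH] k ip nk kb.
    have k1 : k - n \in W n.-1.
      by apply: b_all; rewrite (_ : n.-1 = n - 1 - 0); lia.
    have -> : k = (n - n.-1) * n + (k - n).
      by rewrite (_ : n - n.-1 = 1); lia.
    exact: W_dominate (leq_pred n) k1.
  have [qk|kq] := leqP (i.+2 * n + (n - 1 - i.+1)) k.
    have k1 : k - i.+2 * n \in W (n - 1 - i.+1).
      by apply: b_all; lia.
    have -> : k = (n - (n - 1 - i.+1)) * n + (k - i.+2 * n).
      by rewrite (_ : n - (n - 1 - i.+1) = i.+2); lia.
    by apply: W_dominate k1; lia.
  apply: IH => //; first lia.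
  have := bq (n - 1 - i); nia.
apply: b_max => k /andP[nk kb].
have [kn|kn] := leqP k (2 * n - 2); first by apply: low; lia.
apply: (high (n - 1 - p)); try lia.
have -> : (n - 1 - p).+1 = n - p by lia.
by have -> : n - 1 - (n - 1 - p) = p by lia.
Qed.

(** * Strong components: a large weight forces a large one, which can be resized *)

Definition scc (T : finType) (R : rel T) x := [pred y | R x y && R y x].

(** [R x y + R y x] is at most 1, plus 1 when [x] and [y] lie in the same component. Hence a weight
    close to [#|T| ^ 2] forces a component of nearly full size. *)
Lemma npairs_le_scc (T : finType) (R : rel T) c :
  (forall x, #|scc R x| <= c) -> 2 * npairs R <= #|T| ^ 2 + #|T| * c.
Proof.
move=> sc; have -> : 2 * npairs R = \sum_x \sum_y (R x y + R y x).
  rewrite mul2n -addnn {2}/npairs exchange_big /npairs -big_split /=.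
  by apply: eq_bigr => x _; rewrite big_split.
have -> : #|T| ^ 2 + #|T| * c = \sum_(x : T) (#|T| + c).
  by rewrite sum_nat_const -mulnn mulnDr.
apply: leq_sum => x _.
have -> : \sum_y (R x y + R y x) = \sum_y ((R x y || R y x) + (R x y && R y x)).
  by apply: eq_bigr => y _; case: (R x y); case: (R y x).
rewrite big_split /= leq_add //.
  rewrite -(sum1_card T) leq_sum // => y _; by case: orb.
apply: leq_trans (sc x); rewrite -sum1_card [X in _ <= X]big_mkcond /=.
by rewrite leq_sum // => y _; rewrite inE; case: andb.
Qed.

Section SplitComponent.
Variables (T : finType) (R : rel T) (x0 : T).
Hypotheses (Rxx : reflexive R) (Rtr : transitive R).
Let C := scc R x0.
Let S := [pred x | ~~ C x].
Let P := \sum_(x in S) \sum_(y in S) R x y.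
Let down : nat := \sum_(x in S) R x x0.
Let up : nat := \sum_(x in S) R x0 x.

Lemma scc_swapl x y : x \in C -> R x y = R x0 y.
Proof.
by case/andP=> xz zx; apply/idP/idP; [apply: Rtr xz | apply: Rtr zx].
Qed.

Lemma scc_swapr x y : y \in C -> R x y = R x x0.
Proof.
case/andP=> yz zy; apply/idP/idP => xy; first exact: Rtr xy zy.
exact: Rtr xy yz.
Qed.

(** All vertices of [C] have the same relations to the outside, so [C] enters only through its
    size. *)
Lemma npairs_split : npairs R = #|C| ^ 2 + #|C| * (down + up) + P.
Proof.
have split (F : T -> nat) : \sum_x F x = \sum_(x in C) F x + \sum_(x in S) F x.
  by rewrite (bigID (mem C)).
rewrite /npairs split (eq_bigr (fun=> #|C| + up)); last first.
  move=> x xC; rewrite split; congr (_ + _).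
    rewrite -sum1_card; apply: eq_bigr => y yC.
    by rewrite (scc_swapl _ xC); case/andP: yC => ->.
  by apply: eq_bigr => y _; rewrite (scc_swapl _ xC).
rewrite sum_nat_const [X in _ + X = _](eq_bigr (fun x =>
  #|C| * R x x0 + \sum_(y in S) R x y)); last first.
  move=> x _; rewrite split; congr (_ + _).
  by rewrite -sum_nat_const; apply: eq_bigr => y yC; rewrite (scc_swapr _ yC).
rewrite big_split /= -big_distrr /= -/P -/down.
by rewrite !mulnDr mulnn -!addnA; congr (_ + _); rewrite addnCA.
Qed.

Lemma card_scc_compl : #|C| + #|S| = #|T|.
Proof. by rewrite -(cardC C); congr (_ + _); apply: eq_card. Qed.

Lemma down_up_le : down + up <= #|S|.
Proof.
rewrite /down /up -big_split /= -sum1_card leq_sum // => x.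
by rewrite !inE; case: (R x x0); case: (R x0 x).
Qed.

Lemma npairs_compl_ge : #|S| <= P.
Proof.
rewrite /P -sum1_card leq_sum // => x xS.
by rewrite (bigD1 x) //= Rxx.
Qed.

Lemma npairs_compl_le : P <= #|S| ^ 2.
Proof.
rewrite -mulnn -sum_nat_const leq_sum // => x xS.
by rewrite -[leqRHS]sum1_card leq_sum // => y _; case: (R x y).
Qed.

(** A full block of [m] vertices replaces [C] and inherits its relations to the outside. *)
Lemma resize_scc m : P + m ^ 2 + m * (down + up) \in W (#|S| + m).
Proof.
pose U : finType := {x | x \in S}.
pose Q := sum_rel (fun x y : U => R (val x) (val y)) (fun x => R (val x) x0)
  (fun x => R x0 (val x)) (fun _ _ : 'I_m => true).
have -> : P + m ^ 2 + m * (down + up) = npairs Q.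
  rewrite npairs_sum_rel card_ord /P /down /up /npairs !sum_nat_const card_ord.
  rewrite muln1 mulnn !(big_sub (mem S)) /=; congr (_ + _ + _).
  by apply: eq_bigr => x _; rewrite (big_sub (mem S)).
apply: npairs_in_W.
- by case=> x /=.
- by case=> x [y|y] [z|z] //=; do ?[exact: Rtr | by move=> *; exact: Rxx].
- by rewrite card_sum card_ord card_sig; congr (_ + _); apply: eq_card.
Qed.
End SplitComponent.

(* The component C with s vertices outside it is forced to satisfy
   2 s - rho = p, where rho counts the outside vertices comparable to C;
   shrinking C to p - s vertices then leaves a digraph of weight x. *)
Lemma W_shrink n p x : 0 < p -> 3 * p <= n -> 0 < x <= n + p - 2 ->
  p.+1 ^ 2 < n + x -> (n - p) * n + x \in W n -> x \in W p.
Proof.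
move=> p0 pn /andP[x0 xn] px /in_W_preorder[R [Rxx Rtr kE]].
have n0 : 0 < n by lia.
pose i0 := Ordinal n0.
case: (@arg_maxnP _ i0 predT (fun y => #|scc R y|)) => // y _ ymax.
have := @npairs_le_scc _ R _ (fun z => ymax z isT).
have := card_scc_compl R y; have := down_up_le R y.
have := npairs_compl_ge y Rxx; have := npairs_compl_le R y.
have := npairs_split y Rtr; have := resize_scc y Rxx Rtr.
rewrite kE card_ord.
set c := #|scc R y|; set s := #|_|; set P := \sum_(i in _) _; set rho := (_ + _)%N.
move=> resize; rewrite -mulnn => split P_le P_ge rho_le cs k_le.
(* By [npairs_le_scc], fewer than 2 p vertices lie outside the component. *)
have c_big : n < c + 2 * p by nia.
suff ps : 2 * s = rho + p.
  have [m mE] : exists m, p = s + m by exists (p - s); lia.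
  have [e eE] : exists e, n = p + e by exists (n - p); lia.
  have {}resize := resize m; rewrite mE.
  have <- // : P + m ^ 2 + m * rho = x.
  have {}split : e * (p + e) + x = (m + e) * (m + e) + (m + e) * rho + P.
    have cE : c = m + e by lia.
    by rewrite -cE -eE (_ : e = n - p) //; lia.
  have rhoE : p = rho + 2 * m by lia.
  by rewrite -mulnn; move: split; rewrite rhoE; lia.
(* [v] counts the outside vertices incomparable to the component; the goal becomes s + v = p. *)
have [v vE] : exists v, s = rho + v by exists (s - rho); lia.
have E : x + n * (s + v) = p * n + s * v + P.
  have en : (n - p) * n + p * n = n * n by rewrite -mulnDl subnK //; lia.
  move: split en; have -> : n = c + s by lia.
  by rewrite vE; lia.
suff : s + v = p by lia.
apply/eqP; have [//|] := eqVneq; rewrite neq_ltn => /orP[spv|pspv].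
  (* If s + v < p, then x >= n + p - 1. *)
  have [w wE] : exists w, p = s + v + 1 + w by exists (p - (s + v + 1)); lia.
  have {}E : x = (1 + w) * n + s * v + P. by move: E; rewrite wE; lia.
  have wn : w <= w * n by rewrite leq_pmulr.
  have [s0|s1] := posnP s; first by move: E vE; rewrite s0 mul0n; lia.
  have sv : v <= s * v by rewrite leq_pmull.
  by lia.
(* If s + v > p, then P <= s^2 and s < 2 p force n + x <= (p + 1)^2. *)
have [u uE] : exists u, s + v = p + 1 + u by exists (s + v - (p + 1)); lia.
have {}E : x + (1 + u) * n <= s * (p + 1 + u).
  by rewrite -uE mulnDr mulnn; move: E; rewrite uE; lia.
have [sp|ps] := leqP s (p + 1).
  have su : s * (p + 1 + u) <= (p + 1) * (p + 1 + u) by rewrite leq_mul2r sp orbT.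
  have pu : (p + 1) * u <= n * u by rewrite leq_mul2r; apply/orP; right; lia.
  by rewrite -mulnn in px; lia.
have [j jE] : exists j, s = p + 1 + j by exists (s - (p + 1)); lia.
have [i iE] : exists i, u = j + i by exists (u - j); lia.
have jn : j * (2 * p + 2 + j) <= j * n by rewrite leq_mul2l; apply/orP; right; lia.
have si : s * i <= n * i by rewrite leq_mul2r; apply/orP; right; lia.
by rewrite -mulnn in px; move: E si; rewrite iE jE; lia.
Qed.

Lemma b_upper n p : 0 < p -> 3 * p <= n -> b p < n + p - 2 ->
  p.+1 ^ 2 <= n + b p -> b n <= (n - p) * n + b p.
Proof.
move=> p0 pn bpn pb; rewrite -ltnS -addnS; apply: b_lt; first by have := b_ge p; nia.
apply: contra (b_notin p); apply: W_shrink; rewrite ?addnS ?ltnS //.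
Qed.

(** The missing weight is now [p ^ 2 + 1], larger than any weight on [p] vertices; this serves small
    [n]. *)
Lemma b_upper_sqr n p : 2 < p -> 3 * p <= n -> p ^ 2 < n + p - 2 ->
  b n <= (n - p) * n + p ^ 2.
Proof.
move=> p0 pn ppn; rewrite -ltnS -addnS; apply: b_lt; first nia.
have : p ^ 2 + 1 \notin W p by apply/negP => /W_le_sqr; rewrite addn1 ltnn.
rewrite addn1; apply: contra; apply: W_shrink; try lia; rewrite -!mulnn; nia.
Qed.

(** * A table of lower bounds *)

(* The entries of l are meant as lower bounds for b; the entry of index q reaches
   n + q - 2, as b_fill requires, exactly when n < thresholdN l q. *)
Definition thresholdN (l : seq BinNums.N) q : BinNums.N :=
  N.sub (N.add (nth 0%num l q) 3) (N.of_nat q).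

(* For n < 647 the dominated digraph has fewer than 40 vertices. *)
Definition owner (l : seq BinNums.N) n : nat :=
  find (fun q => N.ltb (N.of_nat n) (thresholdN l q.+1)) (iota 0 40).

Definition fill_value (l : seq BinNums.N) n : BinNums.N :=
  let p := owner l n in
  N.add (N.mul (N.of_nat (n - p)) (N.of_nat n)) (nth 0%num l p).

Definition b_table : seq BinNums.N :=
  iter 644 (fun l => rcons l (fill_value l (size l))) [:: 0; 1; 4]%num.

(* A lower bound for 8 f m; k bounds the depth of the recursion. *)
Fixpoint defect_eighths k (m : BinNums.N) : BinNums.N :=
  if k is k'.+1 then
    if N.ltb m 5 then 0%num else
    N.add (N.sub (N.sqrt (N.mul 64 m)) 8)
          (N.div (defect_eighths k' (N.sqrt m)) 2)
  else 0%num.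

Definition fill_ok (l : seq BinNums.N) n : bool :=
  [&& (owner l n).+1 < n, N.ltb (N.of_nat n) (thresholdN l (owner l n).+1)
    & N.eqb (nth 0%num l n) (fill_value l n)].

(** This is 8 times (p - 2) n < b p + n f n, taken at the largest [n] owned by [p], with f bounded
    below at the smallest such [n]. *)
Definition estimate_ok (l : seq BinNums.N) p : bool :=
  let h := N.pred (thresholdN l p.+1) in
  N.ltb (N.mul (N.mul (N.of_nat (p - 2)) 8) h)
        (N.add (N.mul 8 (nth 0%num l p))
               (N.mul (defect_eighths 4 (thresholdN l p)) h)).

(** Since the thresholds increase, one comparison at the index after the owner settles all larger
    indices. The number 390625 is 625^2. *)
Definition table_ok (l : seq BinNums.N) : bool :=
  [&& all (fill_ok l) (iota 3 644), all (estimate_ok l) (iota 1 645),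
      sorted N.ltb (map (thresholdN l) (iota 1 646)),
      [&& N.eqb (thresholdN l 1) 3, N.eqb (nth 0%num l 1) 1
        & N.eqb (nth 0%num l 2) 4]
    & N.ltb 390625 (thresholdN l 646)].

Lemma b_table_ok : table_ok b_table.
Proof. by vm_cast_no_check (erefl true). Qed.

Section Table.
Variable l : seq BinNums.N.
Hypothesis l_ok : table_ok l.

Definition table_value p : nat := N.to_nat (nth 0%num l p).
Definition table_limit p : nat := N.to_nat (thresholdN l p).

Lemma table_limitE p : table_limit p = table_value p + 3 - p.
Proof. by rewrite /table_limit /thresholdN /table_value; clear; lia. Qed.

Lemma table_limit_mono p q : 0 < p -> p < q -> q <= 646 -> table_limit p < table_limit q.
Proof.
move=> p0 pq qn; have /and5P[_ _ Ts _ _] := l_ok.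
have Ntr : transitive N.ltb by move=> y x z; lia.
have := sorted_ltn_nth Ntr 0%num Ts.
move/(_ p.-1 q.-1); rewrite !inE size_map size_iota.
have -> : p.-1 < 646 by lia.
have -> : q.-1 < 646 by lia.
have -> : p.-1 < q.-1 by lia.
move=> /(_ isT isT isT).
rewrite !(nth_map 0) ?size_iota ?nth_iota; try lia.
by rewrite /table_limit !add1n !prednK //; lia.
Qed.

Lemma table_limit1 : table_limit 1 = 3.
Proof. by have /and5P[_ _ _ /and3P[/N.eqb_spec h _ _] _] := l_ok; rewrite /table_limit h. Qed.

Lemma table_limit_last : 625 * 625 < table_limit 646.
Proof. by have /and5P[_ _ _ _] := l_ok; rewrite /table_limit; lia. Qed.

(** Strong induction: the thresholds of all [r] above the owner exceed [q], so the induction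
    hypothesis supplies the overlaps that [b_fill] asks for. *)
Lemma table_value_le_b q : 0 < q <= 646 -> table_value q <= b q.
Proof.
have /and5P[/allP ok _ _ /and3P[_ /N.eqb_spec c1 /N.eqb_spec c2] _] := l_ok.
elim/ltn_ind: q => q IH /andP[q0 qn].
have [q3|] := leqP 3 q; last first.
  case: q q0 qn IH => [|[|[|q]]] // _ _ _ _; rewrite /table_value ?c1 ?c2; first exact: b_ge.
  apply: b_max => k /andP[k2 k4].
  have [-> | [-> | ->]] : k = 2 \/ k = 3 \/ k = 4 by rewrite /= in k4; lia.
  - exact: n_in_W.
  - exact: (W_add true (n_in_W 1) (n_in_W 1)).
  - exact: (W_sqr 2).
have q_in : q \in iota 3 644 by rewrite mem_iota; lia.
have /and3P[] := ok _ q_in.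
set p := owner _ q => pq /N.ltb_spec0 qT /N.eqb_spec cE.
have p0 : 0 < p.
  by case: p pq qT cE => // _ + _; have := table_limit1; rewrite /table_limit; lia.
have -> : table_value q = (q - p) * q + table_value p.
  by rewrite /table_value cE /fill_value -/p; lia.
apply: leq_trans (b_fill pq _); first by rewrite leq_add2l IH //; lia.
move=> r /andP[pr rq]; apply: leq_trans (IH r rq _); last lia.
have : q < table_limit r.
  apply: (@leq_trans (table_limit p.+1)); first by rewrite /table_limit; lia.
  by have [<- // | pr'] := eqVneq p.+1 r; apply/ltnW/table_limit_mono; lia.
by rewrite table_limitE; lia.
Qed.

Lemma table_estimate p : 0 < p < 646 ->
  (p - 2) * 8 * (table_limit p.+1).-1 <
  8 * table_value p +
  N.to_nat (defect_eighths 4 (N.of_nat (table_limit p))) * (table_limit p.+1).-1.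
Proof.
have /and5P[_ /allP ok _ _ _] := l_ok => /andP[p0 pn].
have p_in : p \in iota 1 645 by rewrite mem_iota; lia.
by have /N.ltb_spec0 := ok _ p_in; rewrite /table_limit /table_value N2Nat.id; lia.
Qed.

Lemma table_limit_locate n : 3 <= n < table_limit 646 ->
  exists p, 0 < p < 646 /\ table_limit p <= n < table_limit p.+1.
Proof.
case/andP=> n3 nT.
have ex : exists i, n < table_limit i.+1 by exists 645.
case: (ex_minnP ex) => p np pmin; exists p.
have p0 : 0 < p by case: p np {pmin} => //; rewrite table_limit1; lia.
split; first by have := pmin 645 nT; lia.
rewrite np andbT leqNgt; apply/negP => npT.
by have := pmin p.-1; rewrite prednK // => /(_ npT); lia.
Qed.
End Table.

(** * The normalised defect of g *)

Local Open Scope ring_scope.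

(** The argument is real because the recursion passes from n to its square root. *)
Definition levels (R : realType) (x : R) : int := Num.floor (log 2 (log 5 x)) + 1.

Definition defect (R : realType) (x : R) : R :=
  \sum_(1 <= j < (Num.truncn (levels x)).+1) x `^ (1 / 2 ^+ j) / 2 ^+ (j - 1)
  - (2 - 1 / 2 ^ (levels x - 1)).

Lemma g_defect (R : realType) n : (0 < n)%N ->
  g R n = n%:R ^+ 2 - n%:R * defect (n%:R : R).
Proof.
move=> n0; rewrite /g /defect -[Defs.N R n]/(levels (n%:R : R)).
rewrite (eq_bigr (fun j => n%:R * (n%:R `^ (1 / 2 ^+ j) / 2 ^+ (j - 1)))); last first.
  move=> j _; rewrite powRD; last by rewrite pnatr_eq0 -lt0n n0 implybT.
  by rewrite powRr1 // mulrA.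
by rewrite -mulr_sumr; ring.
Qed.

Section Defect.
Variable R : realType.
Implicit Types x y z : R.

Lemma sqr_ge5_gt2 z : 0 < z -> 5 <= z ^+ 2 -> 559 / 250 < z.
Proof. by move=> z0 z5; nra. Qed.

Lemma log5_gt0 z : 1 < z -> 0 < log 5 z.
Proof. by move=> z1; rewrite /log divr_gt0 ?ln_gt0 //; lra. Qed.

(** Squaring doubles the inner logarithm and so adds 1 to the outer one. *)
Lemma levels_sqr z : 1 < z -> levels (z ^+ 2) = levels z + 1.
Proof.
move=> z1; rewrite /levels; congr (_ + 1).
have -> : log 2 (log 5 (z ^+ 2)) = log 2 (log 5 z) + 1.
  have l2 : ln (2 : R) != 0 by rewrite gt_eqF // ln_gt0; lra.
  have -> : log 5 (z ^+ 2) = 2 * log 5 z.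
    by rewrite /log lnXn ?[in RHS]mulrA ?mulr_natl //; lra.
  rewrite /log lnM ?posrE; [by field | lra |].
  exact: log5_gt0.
by rewrite floorDrz ?floor1.
Qed.

Lemma levels_small z : 0 < z -> 5 <= z ^+ 2 -> z < 5 -> levels z = 0.
Proof.
move=> z0 z5 zl; have z2 := sqr_ge5_gt2 z0 z5.
have l2 : 0 < ln (2 : R) by rewrite ln_gt0; lra.
have l5 : 0 < ln (5 : R) by rewrite ln_gt0; lra.
have lz : log 5 z < 1.
  by rewrite /log ltr_pdivrMr // mul1r ltr_ln ?posrE; lra.
have lz' : 1 / 2 <= log 5 z.
  rewrite /log ler_pdivlMr //; have : ln 5 <= ln (z ^+ 2) by rewrite ler_ln ?posrE; nra.
  by rewrite lnXn // -mulr_natl; lra.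
suff /eqP fl : Num.floor (log 2 (log 5 z)) == -1 by rewrite /levels fl.
rewrite floor_eq; set l := log 5 z in lz lz' *; rewrite /log; apply/andP; split.
  rewrite ler_pdivlMr // mulrN1z mulN1r -lnV ?posrE; last lra.
  by rewrite ler_ln ?posrE; lra.
rewrite subrr ltr_pdivrMr // mul0r ln_lt0 //; apply/andP; split; lra.
Qed.

Lemma defect_small z : 0 < z -> 5 <= z ^+ 2 -> z < 5 -> defect z = 0.
Proof.
move=> z0 z5 zl; rewrite /defect levels_small // truncn0 big_geq //.
by rewrite (_ : 0 - 1 = -1)// exprN1; field.
Qed.

(** Repeated square roots bring any x >= sqrt 5 into [sqrt 5, 5). *)
Lemma sqrt_tower_ind (P : R -> Prop) :
  (forall z, 0 < z -> 5 <= z ^+ 2 -> z < 5 -> P z) ->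
  (forall z, 0 < z -> 5 <= z ^+ 2 -> P z -> P (z ^+ 2)) ->
  forall x, 0 < x -> 5 <= x ^+ 2 -> P x.
Proof.
move=> P0 PS x x0 x5.
have [K xK] : exists K : nat, x < 5 ^+ (2 ^ K).
  exists (Num.truncn x).+1; apply: lt_le_trans (truncnS_gt x) _.
  rewrite -natrX ler_nat; apply: leq_trans (ltnW (ltn_expl _ (isT : 1 < 5)%N)).
  exact: ltnW (ltn_expl _ _).
elim: K x x0 x5 xK => [|K IH] x x0 x5 xK; first exact: P0.
have [xlt5|x_ge5] := ltrP x 5; first exact: P0.
have sx : Num.sqrt x ^+ 2 = x by rewrite sqr_sqrtr // ltW.
rewrite -sx; apply: PS; rewrite ?sqrtr_gt0 ?sx //.
apply: IH; rewrite ?sqrtr_gt0 ?sx //.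
rewrite -(@ltr_pXn2r _ 2) ?nnegrE ?sqrtr_ge0 ?exprn_ge0 //.
by rewrite sx -exprM mulnC -expnS.
Qed.

Lemma levels_ge0 z : 0 < z -> 5 <= z ^+ 2 -> 0 <= levels z.
Proof.
move: z; apply: sqrt_tower_ind => z z0 z5 => [zl|IH]; first by rewrite levels_small.
by rewrite levels_sqr; [lia | have := sqr_ge5_gt2 z0 z5; lra].
Qed.

(** The first term of the sum for [z ^+ 2] is [z]; the others are the terms for [z], halved. *)
Lemma defect_sqr z : 0 < z -> 5 <= z ^+ 2 ->
  defect (z ^+ 2) = z - 1 + defect z / 2.
Proof.
move=> z0 z5; have L0 := levels_ge0 z0 z5.
rewrite /defect levels_sqr; last by have := sqr_ge5_gt2 z0 z5; lra.
case: (levels z) L0 => // M _.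
have truncnZ (m : nat) : Num.truncn (m : int) = m by rewrite -[in LHS](natz m) natrK.
have -> : Num.truncn (M%:Z + 1) = M.+1 by rewrite -PoszD addn1 truncnZ.
rewrite truncnZ.
rewrite big_nat_recl //.
rewrite (eq_big_nat _ _ (F2 := fun j => z `^ (1 / 2 ^+ j) / 2 ^+ (j - 1) / 2)).
  rewrite -mulr_suml subnn expr0 divr1 expr1 mul1r powR12_sqrt ?exprn_ge0 ?ltW //.
  rewrite sqrtr_sqr gtr0_norm // addrK.
  rewrite expfzDr ?exprN1; last by rewrite pnatr_eq0.
  have e0 : (2 ^ M%:Z : R) != 0 by rewrite expfz_neq0 // pnatr_eq0.
  set S := \sum_(_ <= _ < _) _; set e := (2 ^ M%:Z : R) in e0 *.
  by field.
case=> // j _; rewrite !subn1 /= -powR_mulrn ?ltW // -powRrM.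
have p0 k : (2 ^+ k : R) != 0 by rewrite expf_neq0 // pnatr_eq0.
have -> : 2%:R * (1 / 2 ^+ j.+2) = 1 / 2 ^+ j.+1 :> R.
  by rewrite (exprS _ j.+1); field; rewrite p0.
by rewrite (exprS _ j); field; rewrite p0.
Qed.
End Defect.

(** * Size and growth of the defect *)

Section DefectEstimates.
Variable R : realType.
Implicit Types x y z w r q : R.

Lemma sqrt_param x : 5 <= x -> exists z, [/\ 0 < z, 5 <= z ^+ 2, x = z ^+ 2 & Num.sqrt x = z].
Proof.
move=> x5; exists (Num.sqrt x).
by rewrite sqrtr_gt0 sqr_sqrtr; [split=> //; lra | lra].
Qed.

Lemma le_of_sqr z w : 0 < z -> 0 < w -> z ^+ 2 <= w ^+ 2 -> z <= w.
Proof. by move=> /ltW z0 /ltW w0; rewrite ler_pXn2r. Qed.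

Lemma defect_ge0 x : 0 < x -> 5 <= x ^+ 2 -> 0 <= defect x.
Proof.
move: x; apply: sqrt_tower_ind => z z0 z5 => [zl|IH]; first by rewrite defect_small.
by rewrite defect_sqr //; have := sqr_ge5_gt2 z0 z5; lra.
Qed.

Lemma defect_mono x y : 0 < x -> 5 <= x ^+ 2 -> x <= y -> defect x <= defect y.
Proof.
move=> x0 x5; move: x x0 x5 y; apply: sqrt_tower_ind => z z0 z5 => [zl|IH] y zy.
  by rewrite defect_small // defect_ge0 //; nra.
have [w [w0 w5 yE _]] := sqrt_param (le_trans z5 zy).
have zw : z <= w by apply: le_of_sqr; rewrite -?yE.
rewrite yE !defect_sqr //; by have := IH _ zw; lra.
Qed.

(** This affine bound reproduces itself under the recursion; it is nearly attained at z = sqrt 5. *)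
Lemma defect_le_sqrt z : 0 < z -> 5 <= z ^+ 2 -> defect (z ^+ 2) <= 5 / 4 * z - 311 / 200.
Proof.
move: z; apply: sqrt_tower_ind => z z0 z5 => [zl|IH].
  by rewrite defect_sqr // defect_small //; have := sqr_ge5_gt2 z0 z5; lra.
rewrite defect_sqr; [|by rewrite exprn_gt0|]; have := sqr_ge5_gt2 z0 z5; nra.
Qed.

Lemma defect_le_lin x : 5 <= x -> defect x <= 13 / 50 * x - 3 / 50.
Proof.
move=> /sqrt_param[z [z0 z5 -> _]]; have z2 := sqr_ge5_gt2 z0 z5.
have [zl|zg] := ltrP z 5.
  by rewrite defect_sqr // defect_small //; nra.
by apply: le_trans (defect_le_sqrt z0 z5) _; nra.
Qed.

Lemma defect_le_sqrt_large z : 5 <= z -> defect (z ^+ 2) <= 113 / 100 * z - 103 / 100.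
Proof.
by move=> z5; rewrite defect_sqr; [have := defect_le_lin z5; lra | lra | nra].
Qed.

(** A Lipschitz bound in the square root, up to an additive jump [J], for r >= sqrt c. *)
Definition defect_growth (A J c : R) := forall r q, 0 < r -> c <= r ^+ 2 -> r <= q ->
  defect q - defect r <= A * (Num.sqrt q - Num.sqrt r) + J.

Lemma sqrt_sub_le s z w : 0 < s -> s ^+ 4 <= z ^+ 2 -> 0 < z -> z <= w ->
  0 <= Num.sqrt w - Num.sqrt z <= (w - z) / (2 * s).
Proof.
move=> s0 sz z0 zw; set a := Num.sqrt z; set b := Num.sqrt w.
have aE : a ^+ 2 = z by rewrite sqr_sqrtr ?ltW.
have bE : b ^+ 2 = w by rewrite sqr_sqrtr // ltW // (lt_le_trans z0).
have a0 : 0 <= a by exact: sqrtr_ge0.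
have ab : a <= b by rewrite ler_wsqrtr.
have sa : s <= a.
  rewrite -(@ler_pXn2r _ 4) ?nnegrE //; last exact: ltW.
  by apply: le_trans sz _; rewrite -aE -exprM.
rewrite subr_ge0 ab ler_pdivlMr; last lra.
by rewrite -aE -bE; nra.
Qed.

(* J allows for the jumps of defect at 5 ^ (2 ^ k): one level of the recursion
   halves J and brings the slope A closer to 1. *)
Lemma defect_growth_step A J c s A' J' :
  0 <= A -> 0 < s -> s ^+ 4 <= c -> 5 <= c -> 1 + A / (4 * s) <= A' -> J / 2 <= J' ->
  defect_growth A J c -> defect_growth A' J' (c ^+ 2).
Proof.
move=> A0 s0 sc c5 AA' JJ' g r q r0 cr rq.
have cr' : c <= r by apply: le_of_sqr => //; lra.
have r5 := le_trans c5 cr'.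
have [z [z0 z5 zE ->]] := sqrt_param r5.
have [w [w0 w5 wE ->]] := sqrt_param (le_trans r5 rq).
have zw : z <= w by apply: le_of_sqr; rewrite -?zE -?wE.
rewrite zE wE !defect_sqr //.
have cz : c <= z ^+ 2 by rewrite -zE.
have /andP[d0 d1] := sqrt_sub_le s0 (le_trans sc cz) z0 zw.
have := g _ _ z0 cz zw.
have : A * (Num.sqrt w - Num.sqrt z) <= A * ((w - z) / (2 * s)) by rewrite ler_wpM2l.
have -> : A * ((w - z) / (2 * s)) = 2 * ((w - z) * (A / (4 * s))).
  by field; lra.
have : (w - z) * (1 + A / (4 * s)) <= (w - z) * A' by rewrite ler_wpM2l // subr_ge0.
by lra.
Qed.

Lemma defect_growth0 : defect_growth (5 / 4) (249 / 200) 5.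
Proof.
move=> r q r0 r5; move: r r0 r5 q; apply: sqrt_tower_ind => z z0 z5 => [zl|IH] q zq.
  rewrite (defect_small z0) // subr0.
  (* 56/25 just exceeds sqrt 5, and 5/4 * 56/25 - 311/200 is the jump 249/200. *)
  have sz : Num.sqrt z <= 56 / 25.
    have -> : 56 / 25 = Num.sqrt ((56 / 25) ^+ 2) :> R.
      by rewrite sqrtr_sqr ger0_norm //; lra.
    by apply: ler_wsqrtr; lra.
  have sz0 : 0 <= Num.sqrt z by exact: sqrtr_ge0.
  have sq : Num.sqrt z <= Num.sqrt q by exact: ler_wsqrtr.
  have [ql|q5] := ltrP q 5.
    have q0 : 0 < q by exact: lt_le_trans zq.
    have q_ge : 5 <= q ^+ 2.
      by apply: le_trans z5 _; rewrite ler_pXn2r ?nnegrE // ltW.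
    by rewrite (defect_small q0 q_ge ql); clear - sq; lra.
  have [w [w0 w5 -> wE]] := sqrt_param q5.
  rewrite sqrtr_sqr gtr0_norm //.
  have := defect_le_sqrt w0 w5; lra.
have [w [w0 w5 wE ->]] := sqrt_param (le_trans z5 zq).
have zw : z <= w by apply: le_of_sqr; rewrite -?wE.
rewrite wE !defect_sqr // sqrtr_sqr gtr0_norm //.
have s4 : (149 / 100) ^+ 4 <= z ^+ 2 by apply: le_trans z5; lra.
have /andP[d0 d1] := sqrt_sub_le (ltac:(lra) : 0 < 149 / 100 :> R) s4 z0 zw.
by have := IH _ zw; lra.
Qed.

(** The values 1.495, 2.236 and 5 of [s] are lower bounds for the fourth roots of 5, 25 and 625. The
    result covers r >= 625. *)
Lemma defect_growth3 : defect_growth (106 / 100) (156 / 1000) (((5 ^+ 2) ^+ 2) ^+ 2).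
Proof.
apply: (@defect_growth_step (1136 / 1000) (312 / 1000) _ 5); try lra.
apply: (@defect_growth_step (121 / 100) (623 / 1000) _ (2236 / 1000)); try lra.
apply: (@defect_growth_step (5 / 4) (249 / 200) _ (1495 / 1000)); try lra.
exact: defect_growth0.
Qed.

(* For r = a ^+ 2 and q = r + defect r / 2 + e, the growth estimate and
   defect r = O(sqrt r) give defect q = defect r + O(1). *)
Lemma defect_gap a e q : 25 <= a -> 0 <= e <= 198 / 100 ->
  a ^+ 2 + defect (a ^+ 2) / 2 + e <= q ->
  a ^+ 2 - defect (a ^+ 2) / 2 + e - 487 / 1000 <= q - defect q.
Proof.
move=> a25 /andP[e0 e1]; set F := defect _ => qF.
have F1 : F <= 113 / 100 * a - 103 / 100 by apply: defect_le_sqrt_large; lra.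
have a2 : 625 <= a ^+ 2 by nra.
have F0 : 0 <= F by apply: defect_ge0; nra.
have q5 : 5 <= q by lra.
have [s [s0 s5 sE _]] := sqrt_param q5.
have a_le_s : a <= s by apply: le_of_sqr; lra.
have : defect q - F <= 106 / 100 * (s - a) + 156 / 1000.
  have := @defect_growth3 (a ^+ 2) q.
  rewrite sE !sqrtr_sqr !gtr0_norm //; last lra.
  apply; [by rewrite exprn_gt0 //; lra | | by rewrite -sE; lra].
  have -> : ((5 ^+ 2) ^+ 2) ^+ 2 = (25 ^+ 2) ^+ 2 :> R by have <- : 5 ^+ 2 = 25 :> R by lra.
  have aa : 25 ^+ 2 <= a ^+ 2 by lra.
  by rewrite ler_pXn2r ?nnegrE ?exprn_ge0 //; lra.
set d := q - a ^+ 2.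
have dq : F / 2 + e <= d by rewrite /d; lra.
have dE : d = (s - a) * (s + a) by rewrite /d sE; ring.
(* 331/1000 and the jump 156/1000 add up to 487/1000. After multiplication by [a], [sa] absorbs the
   growth term into [d]. *)
suff : 106 / 100 * (s - a) - 331 / 1000 <= d - (F / 2 + e) by rewrite /d; lra.
have sa : 2 * a * (s - a) <= d by rewrite dE; nra.
have h : 53 / 100 * (F / 2 + e) <= 331 / 1000 * a by nra.
suff : a * (106 / 100 * (s - a) - 331 / 1000 - (d - (F / 2 + e))) <= 0.
  by rewrite pmulr_rle0; clear - a25; lra.
have : (a - 53 / 100) * (F / 2 + e) <= (a - 53 / 100) * d by rewrite ler_wpM2l //; lra.
by lra.
Qed.
(** Applied with e = 1.98 and e = 0.98, where [e + 51 / 50] is 3 and 2: the former gives the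
    overlaps for q > p, the latter a lower bound for b p. *)
Lemma defect_gap_mul a e q : 25 <= a -> 0 <= e <= 198 / 100 ->
  a ^+ 2 + defect (a ^+ 2) / 2 + e <= q ->
  (a ^+ 2) ^+ 2 + (e - 198 / 100) * a ^+ 2 - 2 <= q * (q - defect q - (e + 51 / 50)).
Proof.
move=> a25 e_itv qF; have := defect_gap a25 e_itv qF.
have : defect (a ^+ 2) / 2 <= 565 / 1000 * a - 515 / 1000.
  by have := @defect_le_sqrt_large a; lra.
have : 0 <= defect (a ^+ 2) / 2.
  have a2 : 625 <= a ^+ 2 by nra.
  by rewrite divr_ge0 // defect_ge0 ?exprn_gt0 //; nra.
move: qF e_itv; set h := defect _ / 2; clearbody h; move: (defect q) => d qh /andP[e0 e1] h0 ha g.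
have aa : 25 * a <= a ^+ 2 by rewrite expr2 ler_wpM2r //; lra.
set r := a ^+ 2 in qh g aa *.
have hh : (h + 198 / 100) * (h + 1507 / 1000) <= 473 / 1000 * r.
  apply: (@le_trans _ _ ((565 / 1000 * a + 1465 / 1000) * (565 / 1000 * a + 992 / 1000))).
    by clear - a25 h0 ha; apply: ler_pM; lra.
  by rewrite /r in aa *; clear - a25 aa; lra.
have eh : (h + e) * (h + 1507 / 1000) <= (h + 198 / 100) * (h + 1507 / 1000).
  by clear - e1 h0; apply: ler_wpM2r; lra.
apply: (@le_trans _ _ ((r + h + e) * (r - h - 1507 / 1000))); last first.
  by clear - a25 aa e0 h0 ha g qh; apply: ler_pM; lra.
by clear - hh eh; lra.
Qed.
End DefectEstimates.

(** * The two estimates *)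

Section LowerBound.
Variable R : realType.
Local Notation f n := (defect (n%:R : R)).

Lemma nat_sqr_ge5 n : (3 <= n)%N -> 0 < n%:R :> R /\ 5 <= (n%:R : R) ^+ 2.
Proof. by rewrite -(ler_nat R) => n3; split; nra. Qed.

(** Both square roots and the halving round down, so the computation follows [defect_sqr] from
    below; the cut-off value 0 is safe because the defect is nonnegative. *)
Lemma defect_eighths_le k m (x : R) : 0 < x -> 5 <= x ^+ 2 -> (N.to_nat m)%:R <= x ->
  (N.to_nat (defect_eighths k m))%:R <= 8 * defect x.
Proof.
elim: k m x => [|k IH] m x x0 x5 mx /=; first by have := defect_ge0 x0 x5; lra.
case: N.ltb_spec0 => m5; first by have := defect_ge0 x0 x5; rewrite /=; lra.
have m5' : (5 <= N.to_nat m)%N by lia.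
move: m5'; rewrite -(ler_nat R) => m5'.
have [z [z0 z5 xE _]] := sqrt_param (le_trans m5' mx).
rewrite xE defect_sqr // N2Nat.inj_add natrD.
have sqr_le (i : nat) (t : R) : 0 < t -> i%:R ^+ 2 <= t ^+ 2 -> i%:R <= t.
  by move=> t0 it; rewrite -(@ler_pXn2r _ 2) ?nnegrE // ltW.
have sz : (N.to_nat (N.sqrt m))%:R <= z.
  apply: sqr_le => //; rewrite -xE -natrX; apply: le_trans mx.
  by rewrite ler_nat -mulnn; have := N.sqrt_spec' m; lia.
have sz' : (N.to_nat (N.sqrt (N.mul 64 m)))%:R <= 8 * z.
  apply: sqr_le; first by lra.
  have -> : (8 * z) ^+ 2 = 8%:R * 8%:R * x by rewrite xE; ring.
  have h : (8 * 8)%:R * (N.to_nat m)%:R <= 8%:R * 8%:R * x.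
    by rewrite natrM ler_wpM2l // mulr_ge0 // ler0n.
  apply: le_trans h; rewrite -natrX -natrM ler_nat -mulnn.
  by have := N.sqrt_spec' (N.mul 64 m); lia.
have half : (N.to_nat (N.div (defect_eighths k (N.sqrt m)) 2))%:R <= 8 * (defect z / 2).
  have := IH (N.sqrt m) z z0 z5 sz.
  set d := defect_eighths k _.
  have : ((2 * N.to_nat (N.div d 2))%N%:R : R) <= (N.to_nat d)%:R.
    by rewrite ler_nat; have := N.Div0.mul_div_le d 2; move: (N.div d 2) => e; lia.
  by rewrite natrM; lra.
set A := N.sqrt _ in sz' *; clearbody A.
have z1 : 1 < z by have := sqr_ge5_gt2 z0 z5; lra.
have : (N.to_nat (N.sub A 8))%:R <= 8 * (z - 1).
  have [A1|A1] := leqP (N.to_nat A) 8.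
    have -> : N.to_nat (N.sub A 8) = 0%N by clear - A1; lia.
    lra.
  have : ((N.to_nat (N.sub A 8) + 8)%N%:R : R) <= (N.to_nat A)%:R.
    by rewrite ler_nat; clear - A1; lia.
  by rewrite natrD; lra.
by lra.
Qed.

Definition b_lower_at n := n%:R ^+ 2 - (f n + 2) * n%:R < (b n)%:R.

Lemma b_lower_fill n p : (p.+1 < n)%N -> (forall q, (p < q < n)%N -> (n + q - 2 <= b q)%N) ->
  p%:R * n%:R - (b p)%:R < (f n + 2) * n%:R -> b_lower_at n.
Proof.
move=> pn bq h; have := b_fill pn bq.
rewrite -(ler_nat R) natrD natrM (@natrB _ n p); last by lia.
by rewrite /b_lower_at; lra.
Qed.

Lemma b_ge_of_lower n q : (3 <= q)%N -> b_lower_at q ->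
  n%:R - 2 <= q%:R * (q%:R - f q - 3) -> (n + q - 2 <= b q)%N.
Proof.
rewrite /b_lower_at => q3 bq nq; have : (n + q)%:R <= (b q + 2)%:R :> R.
  by rewrite !natrD; lra.
by rewrite ler_nat; lia.
Qed.

Lemma b_lower_large n : 625 ^+ 2 <= n%:R :> R ->
  (forall q, (3 <= q < n)%N -> b_lower_at q) -> b_lower_at n.
Proof.
move=> nR IH.
have [r [r0 r5 nE _]] := sqrt_param (ltac:(lra) : 5 <= n%:R :> R).
have r625 : 625 <= r by apply: le_of_sqr; lra.
have [a [a0 a5 rE _]] := sqrt_param (ltac:(lra) : 5 <= r).
have a25 : 25 <= a by apply: le_of_sqr; lra.
have fn : f n = r - 1 + defect r / 2 by rewrite nE defect_sqr.
set F := defect r in fn.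
have F0 : 0 <= F by apply: defect_ge0.
have F1 : F <= 13 / 50 * r - 3 / 50 by apply: defect_le_lin; lra.
(* With p = floor y, every q > p satisfies q >= y, while p itself exceeds y - 1 = r + F/2 + 0.98. *)
pose y := r + F / 2 + 198 / 100.
have y0 : 0 <= y by rewrite /y; lra.
have /andP[py yp] := truncn_itv y0; set p := Num.truncn y in py yp.
move: yp; rewrite -natr1 => yp.
have p_gt : r + F / 2 + 98 / 100 <= p%:R by rewrite /y in yp; lra.
have p3 : (3 <= p)%N by rewrite -(ler_nat R); lra.
have pn : (p.+1 < n)%N by rewrite -(ltr_nat R) -natr1; rewrite /y in py; nra.
have gap e (q : R) : 0 <= e <= 198 / 100 -> r + F / 2 + e <= q ->
    r ^+ 2 + (e - 198 / 100) * r - 2 <= q * (q - defect q - (e + 51 / 50)).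
  by rewrite /F rE; apply: defect_gap_mul.
apply: (@b_lower_fill n p) => //.
  move=> q /andP[pq qn]; have q3 : (3 <= q)%N by exact: leq_trans p3 (ltnW pq).
  apply: b_ge_of_lower => //; first by apply: IH; rewrite q3 qn.
  have qy : y <= q%:R.
    by apply: le_trans (ltW yp) _; rewrite natr1 ler_nat.
  have := gap (198 / 100) _ ltac:(clear; lra) qy.
  by rewrite nE; clear; lra.
have bp : b_lower_at p by apply: IH; rewrite p3 ltnW.
(* p n <= y n exceeds (f n + 2) n by at most 0.98 n, and b p > n - r - 2 outweighs this since r >=
   625. *)
have := gap (98 / 100) _ ltac:(clear; lra) p_gt.
rewrite /b_lower_at in bp.
have : p%:R * n%:R <= y * n%:R by rewrite ler_wpM2r.
have : 625 * r <= r ^+ 2 by rewrite expr2 ler_wpM2r // ltW.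
by rewrite fn /y nE; clear - bp r625; lra.
Qed.

Lemma table_limit_ge l p : table_ok l -> (0 < p <= 646)%N -> (p.+2 <= table_limit l p)%N.
Proof.
move=> l_ok; elim: p => // p IH /andP[_ pn].
have [->|p0] := posnP p; first by rewrite (table_limit1 l_ok).
apply: leq_ltn_trans (IH _) _; first by rewrite p0 ltnW.
by apply: (table_limit_mono l_ok).
Qed.

Lemma b_lower_small l n : table_ok l -> (3 <= n)%N -> n%:R < 625 ^+ 2 :> R ->
  (forall q, (3 <= q < n)%N -> b_lower_at q) -> b_lower_at n.
Proof.
move=> l_ok n3 nR IH.
have nT : (3 <= n < table_limit l 646)%N.
  rewrite n3 /=; apply: leq_trans (ltnW (table_limit_last l_ok)).
  by rewrite -(ltr_nat R) natrM -expr2.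
have [p [/andP[p0 p646] /andP[Tn nTp]]] := table_limit_locate l_ok nT.
have pT : (p.+2 <= table_limit l p)%N by apply: (table_limit_ge l_ok); rewrite p0 ltnW.
apply: (@b_lower_fill n p); first exact: leq_trans pT Tn.
  move=> q /andP[pq qn]; have [q646|q646] := leqP q 646.
    apply: leq_trans (table_value_le_b l_ok _); last by rewrite (leq_trans _ pq).
    have : (n < table_limit l q)%N.
      apply: leq_trans nTp _; have [<- // | pq'] := eqVneq p.+1 q.
      by apply/ltnW/(table_limit_mono l_ok) => //; rewrite ltn_neqAle pq' pq.
    by rewrite table_limitE; lia.
  (* Beyond the table the induction hypothesis suffices, because 647 * 614 > 625^2. *)
  have q3 : (3 <= q)%N by exact: leq_trans (ltnW q646).
  apply: b_ge_of_lower => //; first by apply: IH; rewrite q3 qn.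
  have q647 : 647%:R <= q%:R :> R by rewrite ler_nat.
  have [s [s0 s5 sE _]] := sqrt_param (ltac:(lra) : 5 <= q%:R :> R).
  have s25 : 254 / 10 <= s by apply: le_of_sqr; clear - q647 sE s0; lra.
  have := defect_le_sqrt_large (ltac:(clear - s25; lra) : 5 <= s); rewrite -sE => fq.
  have qs : 614 <= q%:R - f q - 3.
    have ss : 254 / 10 * s <= q%:R by rewrite sE expr2 ler_wpM2r // ltW.
    by clear - ss fq s25; lra.
  have : 647 * 614 <= q%:R * (q%:R - f q - 3) by clear - q647 qs; apply: ler_pM; lra.
  by apply: le_trans; clear - nR; lra.
have [n0 n5] := nat_sqr_ge5 n3.
have Tp3 : (3 <= table_limit l p)%N by rewrite (leq_trans _ pT).
have [T0 T5] := nat_sqr_ge5 Tp3.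
have fT : f (table_limit l p) <= f n by apply: defect_mono; rewrite // ler_nat.
have := table_estimate l_ok (ltac:(by rewrite p0) : (0 < p < 646)%N).
set h := (table_limit l p.+1).-1; set d := N.to_nat (defect_eighths _ _).
have df : d%:R <= 8 * f n.
  have := @defect_eighths_le 4 (N.of_nat (table_limit l p)) _ T0 T5.
  by rewrite Nat2N.id -/d => /(_ (lexx _)); clear - fT; lra.
have cb : (table_value l p <= b p)%N by apply: (table_value_le_b l_ok); rewrite p0 ltnW.
have nh : n%:R <= h%:R :> R by rewrite ler_nat -ltnS /h prednK // (leq_ltn_trans _ nTp).
move: cb; rewrite -(ler_nat R) => cb.
rewrite -(ltr_nat R) natrD !natrM => est.
have p2 : p%:R - 2 <= (p - 2)%:R :> R.
  have : (p%:R : R) <= (p - 2 + 2)%:R by rewrite ler_nat; clear; lia.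
  by rewrite natrD; clear; lra.
set u := (p - 2)%:R in est p2.
(* The tabulated inequality is linear in n: with a nonpositive coefficient the claim is immediate,
   otherwise it descends from [h] to n. *)
have [ud|du] := lerP (u * 8) d%:R.
  have : n%:R * (p%:R - 2) <= n%:R * f n.
    by rewrite ler_wpM2l //; clear - ud df p2; lra.
  have : 0 < (table_value l p)%:R :> R.
    by rewrite ltr0n; move: pT p0; rewrite table_limitE; clear; lia.
  by clear - cb; lra.
have : n%:R * (u * 8 - d%:R) <= h%:R * (u * 8 - d%:R).
  by rewrite ler_wpM2r //; clear - du; lra.
have : n%:R * (p%:R - 2) <= n%:R * u by rewrite ler_wpM2l.
have : n%:R * d%:R <= n%:R * (8 * f n) by rewrite ler_wpM2l.
by clear - est cb; lra.
Qed.

Lemma b_lower n : (3 <= n)%N -> b_lower_at n.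
Proof.
elim/ltn_ind: n => n IH n3.
have IH' q : (3 <= q < n)%N -> b_lower_at q by case/andP=> q3 qn; exact: IH.
have [/b_lower_large|nR] := lerP (625 ^+ 2) (n%:R : R); first exact.
exact: (b_lower_small b_table_ok).
Qed.
End LowerBound.

(** * Upper bound on b *)

Section UpperBound.
Variable R : realType.
Local Notation f n := (defect (n%:R : R)).

Definition b_upper_at n := (b n)%:R < n%:R ^+ 2 - (f n - 2) * n%:R.

Lemma defect_lt2 (x : R) : 0 < x -> 5 <= x ^+ 2 -> x < 9 -> defect x < 2.
Proof.
move=> x0 x5 x9; have [xl|/sqrt_param[z [z0 z5 xE _]]] := ltrP x 5.
  by rewrite defect_small.
have z3 : z < 3 by nra.
by rewrite xE defect_sqr // defect_small //; clear - z3; lra.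
Qed.

Lemma b_upper_tiny n : (3 <= n)%N -> n%:R < 9 :> R -> b_upper_at n.
Proof.
move=> n3 n9; have [n0 n5] := nat_sqr_ge5 R n3.
have : f n < 2 by exact: defect_lt2.
have : (b n)%:R <= n%:R ^+ 2 :> R by rewrite -natrX ler_nat b_le_sqr.
by rewrite /b_upper_at; nra.
Qed.

Lemma b_upper_small n : 9 <= n%:R :> R -> n%:R < 81 :> R -> b_upper_at n.
Proof.
move=> n9 n81.
have [r [r0 r5 nE _]] := sqrt_param (ltac:(clear - n9; lra) : 5 <= n%:R :> R).
have r3 : 3 <= r by apply: le_of_sqr; clear - nE n9 r0; lra.
have r9 : r < 9 by clear - nE n81 r0; nra.
have F2 := defect_lt2 r0 r5 r9.
(* For p = floor (sqrt n) the term p^2 costs at most n, which F < 2 leaves room for. *)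
have /andP[pr rp] := truncn_itv (ltW r0); set p := Num.truncn r in pr rp.
have p3 : (3 <= p)%N by rewrite -ltnS -(ltr_nat R) (le_lt_trans r3).
have p0 : 0 <= p%:R :> R by [].
have pp : (p ^ 2 <= n)%N by rewrite -(ler_nat R) natrX nE ler_pXn2r ?nnegrE // ltW.
have p_n : (3 * p <= n)%N by apply: leq_trans pp; rewrite -mulnn leq_mul2r p3 orbT.
have := @b_upper_sqr n p p3 p_n ltac:(clear - pp p3; lia).
rewrite -(ler_nat R) natrD natrM (@natrB _ n p); last by clear - p_n; lia.
move: pp; rewrite -(ler_nat R) /b_upper_at => pp.
move: rp; rewrite -natr1 => rp.
have : n%:R * (r - 1) <= n%:R * p%:R :> R by rewrite ler_wpM2l //; clear - rp; lra.
have : n%:R * defect r < n%:R * 2 by rewrite ltr_pM2l //; clear - n9; lra.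
have -> : f n = r - 1 + defect r / 2 by rewrite nE defect_sqr.
by clear - pp; lra.
Qed.

Lemma b_upper_large n : 81 <= n%:R :> R ->
  (forall q, (3 <= q < n)%N -> b_upper_at q) -> b_upper_at n.
Proof.
move=> n81 IH.
have [r [r0 r5 nE _]] := sqrt_param (ltac:(clear - n81; lra) : 5 <= n%:R :> R).
have r9 : 9 <= r by apply: le_of_sqr; clear - nE n81 r0; lra.
have fn : f n = r - 1 + defect r / 2 by rewrite nE defect_sqr.
have r_lin : defect r <= 13 / 50 * r - 3 / 50.
  by apply: defect_le_lin; clear - r9; lra.
have F2 : 2 <= defect r.
  have [z [z0 z5 rE _]] := sqrt_param (ltac:(clear - r9; lra) : 5 <= r).
  have z3 : 3 <= z by apply: le_of_sqr; clear - rE r9 z0; lra.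
  by rewrite rE defect_sqr //; have := defect_ge0 z0 z5; clear - z3; lra.
set F := defect r in fn r_lin F2.
(* The offset 9/10 is large enough for [main] and leaves n/10 to spare at the end. *)
pose y := r + F / 2 - 9 / 10.
have y0 : 0 <= y by rewrite /y; clear - r9 F2; lra.
have /andP[py yp] := truncn_itv y0; set p := Num.truncn y in py yp.
move: yp; rewrite -natr1 => yp.
have p81 : 81 / 10 <= p%:R :> R by clear - yp r9 F2; rewrite /y in yp; lra.
have p_lin : p%:R <= 113 / 100 * r - 93 / 100.
  by apply: le_trans py _; rewrite /y; clear - r_lin; lra.
have rr : 9 * r <= n%:R by rewrite nE expr2 ler_wpM2r // ltW.
have p3 : (3 <= p)%N by rewrite -(ler_nat R); clear - p81; lra.
have p_n : (3 * p <= n)%N.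
  by rewrite -(ler_nat R) natrM; clear - p_lin rr r0; lra.
have pltn : (p < n)%N by clear - p_n p3; lia.
have [p0 p5] := nat_sqr_ge5 R p3.
have bp : b_upper_at p by apply: IH; rewrite p3.
have bp' := b_lower R p3.
rewrite /b_upper_at in bp; rewrite /b_lower_at in bp'.
have fp_lin : f p <= 13 / 50 * p%:R - 3 / 50.
  by apply: defect_le_lin; clear - p81; lra.
have fp : 9 / 5 <= f p.
  have [z [z0 z5 pE _]] := sqrt_param (ltac:(clear - p81; lra) : 5 <= p%:R :> R).
  have z28 : 28 / 10 <= z by apply: le_of_sqr; clear - pE p81 z0; lra.
  by rewrite pE defect_sqr //; have := defect_ge0 z0 z5; clear - z28; lra.
(* With the induction hypothesis this gives b p < n + p - 2. Both cases bound the product by r^2 -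
   0.8 r: for p >= r through f p >= F, for p < r through f p >= 9/5. *)
have main : p%:R * (p%:R - f p + 1) <= n%:R - 2.
  have pf : 0 <= p%:R - f p + 1 by clear - fp_lin p81; lra.
  have [rp|pr] := lerP r p%:R.
    have Fp : F <= f p by exact: defect_mono.
    apply: (@le_trans _ _ (y * (r - F / 2 + 1 / 10))).
      by apply: ler_pM => //; clear - py Fp; rewrite /y in py *; lra.
    have : 0 <= (F / 2 - 9 / 10) * (F / 2 - 1 / 10) by apply: mulr_ge0; clear - F2; lra.
    by rewrite nE /y; clear - r9; lra.
  apply: (@le_trans _ _ (r * (r - 8 / 10))).
    by apply: ler_pM => //; clear - pr fp; lra.
  by rewrite nE; clear - r9; lra.
have bpn : (b p < n + p - 2)%N.
  suff : ((b p + 2)%N%:R : R) < (n + p)%N%:R by rewrite ltr_nat; clear; lia.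
  by rewrite !natrD; clear - bp main; lra.
(* The lower bound on b p enters here and reduces the claim to (f p + 4) p + 1 <= n. *)
have pbn : (p.+1 ^ 2 <= n + b p)%N.
  rewrite -(ler_nat R) natrD natrX -natr1.
  have : p%:R * f p <= p%:R * (13 / 50 * p%:R - 3 / 50) by rewrite ler_wpM2l.
  have : p%:R * p%:R <= (113 / 100 * r - 93 / 100) * (113 / 100 * r - 93 / 100).
    by apply: ler_pM.
  by clear - bp' p_lin rr r0 nE; lra.
have := b_upper (leq_trans (isT : 0 < 3)%N p3) p_n bpn pbn.
rewrite -(ler_nat R) natrD natrM (@natrB _ n p); last exact: ltnW.
have : ((b p + 3)%N%:R : R) <= (n + p)%N%:R by rewrite ler_nat; clear - bpn; lia.
rewrite !natrD /b_upper_at fn.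
have : n%:R * (y - 1) < n%:R * p%:R.
  by rewrite ltr_pM2l; [clear - yp; lra | clear - n81; lra].
(* The spare n/10 pays for b p <= n + p - 3. *)
have : p%:R <= n%:R / 10 + 3 :> R by rewrite nE; have := sqr_ge0 (r - 6); clear - p_lin r0; lra.
by rewrite /y; clear - n81; lra.
Qed.

Lemma b_upper_bound n : (3 <= n)%N -> b_upper_at n.
Proof.
elim/ltn_ind: n => n IH n3.
have IH' q : (3 <= q < n)%N -> b_upper_at q by case/andP=> q3 qn; exact: IH.
have [n9|n9] := ltrP (n%:R : R) 9; first exact: b_upper_tiny.
have [n81|n81] := ltrP (n%:R : R) 81; first exact: b_upper_small.
exact: b_upper_large.
Qed.
End UpperBound.

Theorem theorem1p5 (R : realType) (n : nat) (hn : (3 <= n)%N) :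
  `|(b n)%:R - g R n| < 2 * n%:R.
Proof.
have := b_lower R hn; have := b_upper_bound R hn.
rewrite /b_lower_at /b_upper_at ltr_norml (g_defect R (leq_trans (isT : 0 < 3)%N hn)).
by move=> hu hl; apply/andP; split; lra.
Qed.
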